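(* Let $i,j\in\{0,\dots,n_{ini}-1\}$ with $i<j$, and suppose that $N_{c_{ini}^i}(x_{n_{ini}},t')\le N_{c_{ini}^j}(x_{n_{ini}},t')$ for some time $t'\ge \frac{x_{n_{ini}}-x_{i+1}}{v_f}$. Then $$\forall t\ge t',\qquad N_{c_{ini}^i}(x_{n_{ini}},t)\le N_{c_{ini}^j}(x_{n_{ini}},t).$$
   Context: Fundamental diagram: $Q:[0,k_{jam}]\to[0,\infty)$ is a concave function with $Q(0)=Q(k_{jam})=0$. The free-flow speed is $v_f=Q'(0^+)>0$ and the congested wave speed is $w>0$ with $-w=Q'(k_{jam}^-)$ (both finite). The convex transform of $Q$ is $R(u)=\sup_{k\in[0,k_{jam}]}(Q(k)-uk)$ for $u\in[-w,v_f]$. The road link is the interval $[x_0,x_{n_{ini}}]$ with $x_0<x_1<\dots<x_{n_{ini}}$. For $i\in\{0,\dots,n_{ini}-1\}$ the $i$-th initial condition block, imposed at time $0$, is $c_{ini}^i(x)=-k_ix+b_i$ for $x_i\le x\le x_{i+1}$ and $+\infty$ otherwise. The blocks satisfy $0\le k_i\le k_{jam}$ and are continuous at their common endpoints: $c_{ini}^{i}(x_{i+1})=c_{ini}^{i+1}(x_{i+1})$. The solution component $N_{c_{ini}^i}$ associated with block $i$ is given by the Lax-Hopf formula: for $x\in[x_0,x_{n_{ini}}]$ and $t>0$, $$N_{c_{ini}^i}(x,t)=\inf\{c_{ini}^i(y)+t\,R(\tfrac{x-y}{t}) : y\in[x_i,x_{i+1}],\ -w\le \tfrac{x-y}{t}\le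 v_f\},$$ with $N_{c_{ini}^i}(x,0)=c_{ini}^i(x)$ and the infimum over the empty set equal to $+\infty$. *)

(* Defs.v *)
From HB Require Import structures.
From mathcomp Require Import all_boot all_order all_algebra.
From mathcomp Require Import all_classical all_reals all_analysis.

Set Implicit Arguments.
Unset Strict Implicit.
Unset Printing Implicit Defensive.

Import Order.TTheory GRing.Theory Num.Theory.
Import numFieldNormedType.Exports.

Local Open Scope classical_set_scope.
Local Open Scope ring_scope.

Definition is_right_derivative (R : realType) (f : R -> R) (a l : R) : Prop :=
  (f y - f a) / (y - a) @[y --> a^'+] --> l.

Definition is_left_derivative (R : realType) (f : R -> R) (a l : R) : Prop :=
  (f y - f a) / (y - a) @[y --> a^'-] --> l.

(* [Q] is a total function, but no clause depends on its values outside
   [0, kjam]. *)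
Record fundamental_diagram (R : realType) (Q : R -> R) (kjam vf w : R) : Prop :=
  FundamentalDiagram {
    fd_kjam_gt0 : 0 < kjam ;
    fd_ge0 : forall k, 0 <= k <= kjam -> 0 <= Q k ;
    fd_concave : convex_function (`[0, kjam]%classic : set R) (fun k => - Q k) ;
    fd_Q0 : Q 0 = 0 ;
    fd_Qkjam : Q kjam = 0 ;
    fd_vf_gt0 : 0 < vf ;
    fd_w_gt0 : 0 < w ;
    fd_vf : is_right_derivative Q 0 vf ;
    fd_w : is_left_derivative Q kjam (- w) }.

(* The function R(u) of the Lax-Hopf formula. The supremum is taken in the
   extended reals, so no boundedness side condition is needed. *)
Definition convex_transform (R : realType) (Q : R -> R) (kjam u : R) : \bar R :=
  ereal_sup [set (Q k - u * k)%:E | k in `[0, kjam]].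

Definition c_ini (R : realType) (xs k b : nat -> R) (i : nat) (x : R) : \bar R :=
  if xs i <= x <= xs i.+1 then (- k i * x + b i)%:E else +oo%E.

(* Only the entries [xs 0, ..., xs n] and [k i], [b i] with [i < n] are
   constrained; the other values of these sequences are irrelevant. *)
Record initial_blocks (R : realType) (kjam : R) (n : nat) (xs k b : nat -> R) :
    Prop := InitialBlocks {
  ib_increasing : forall i, (i < n)%N -> xs i < xs i.+1 ;
  ib_density : forall i, (i < n)%N -> 0 <= k i <= kjam ;
  ib_continuous : forall i, (i.+1 < n)%N ->
    c_ini xs k b i (xs i.+1) = c_ini xs k b i.+1 (xs i.+1) }.

(* Meaningful for [0 <= t]. [ereal_inf set0 = +oo], which is the convention for
   points unreachable from the block. *)
Definition N_ini (R : realType) (Q : R -> R) (kjam vf w : R)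
    (xs k b : nat -> R) (i : nat) (x t : R) : \bar R :=
  if t == 0 then c_ini xs k b i x
  else ereal_inf
    [set (c_ini xs k b i y + t%:E * convex_transform Q kjam ((x - y) / t))%E
    | y in [set y | xs i <= y <= xs i.+1 /\ - w <= (x - y) / t <= vf]].

(* Main.v *)
Require Import Defs.
From mathcomp Require Import all_boot all_order all_algebra.
From mathcomp Require Import all_classical all_reals all_analysis.
From mathcomp Require Import ring lra.
Import Order.TTheory GRing.Theory Num.Theory.
Local Open Scope ring_scope.

(** The theorem is a no-crossing principle for trajectories that all end at the
    downstream boundary [X = xs n].  A point [y] of the block [i] contributes to
    [N_i(X, t)] the cost [c_i y + t R((X - y) / t)], and the second summand, the
    perspective of the convex function [R], is the cost of the straight
    trajectory from [(y, 0)] to [(X, t)].  Take [y] in block [i], [z] in block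
    [j] and [t' <= t].  As [y <= z <= X], the segment from [(y, 0)] to [(X, t')]
    meets the segment from [(z, 0)] to [(X, t)].  Exchanging the two ends after
    the meeting point, and straightening both resulting broken lines, does not
    increase the total cost by convexity.  This is the exchange inequality
    [convex_perspective_exchange]; taking infima over [y] and [z], it reads
    << N_i(X, t) + N_j(X, t') <= N_i(X, t') + N_j(X, t), >>
    so [N_i <= N_j] propagates from [t'] to [t].

    The lower bound on [t'] makes the exchanged trajectories admissible: at time
    [t'] every point from [xs i.+1] on, hence all of block [j], is within reach
    of [X] at speed at most [vf].  Subtracting costs requires [R] to take finite
    values, which follows from the boundedness of a concave [Q] that vanishes at
    both ends ([diagram_le]). *)

(** * Convex functions and their perspectives *)

(** The weights of [convex_function] live in a bundled unit interval; this form
    takes them as bare scalars, ready for arithmetic. *)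
Lemma convex_functionP (R : numFieldType) (D : set R) (f : R -> R) :
  convex_function (D : set (convex_lmodType R^o)) f <->
  forall p x y : R, 0 <= p <= 1 -> D x -> D y ->
    f (p * x + (1 - p) * y) <= p * f x + (1 - p) * f y.
Proof.
split=> [cf p x y /andP[p0 p1] Dx Dy|cf p x y /set_mem Dx /set_mem Dy].
  by apply: (cf (Itv01 p0 p1)); exact/mem_set.
by apply: cf => //; apply/andP; split.
Qed.

(** Two crossing segments end at the same abscissa after covering the distances
    [a] in time [t'] and [b] in time [t].  Exchanging their ends gives the average
    velocities [a / t] and [b / t'], which both lie between [b / t] and [a / t'];
    convexity bounds [f] at each, and the interpolation weights [p] and [q]
    satisfy [t * p = t' * q], so that the two bounds add up to the right-hand
    side. *)
Lemma convex_perspective_exchange (R : realFieldType) (f : R -> R)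
    (a b t t' : R) :
  convex_function (setT : set (convex_lmodType R^o)) f ->
  0 <= b -> b <= a -> 0 < t' -> t' <= t ->
  t * f (a / t) + t' * f (b / t') <= t' * f (a / t') + t * f (b / t).
Proof.
move=> /convex_functionP cf b0 ba t'0 t't.
have t0 : 0 < t by exact: lt_le_trans t't.
have [tt'|tt'] := eqVneq t t'; first by rewrite tt' addrC.
have [eab|nab] := eqVneq a b; first by rewrite eab addrC.
have {}t't : t' < t by rewrite lt_neqAle eq_sym tt'.
have {}ba : b < a by rewrite lt_neqAle eq_sym nab.
have D0 : 0 < a * t - b * t' by nra.
(* The segments meet at time [s = t t' (a - b) / (a t - b t')], and [p = s / t],
   [q = s / t'] are the fractions of the two journeys covered by then. *)
pose p := t' * (a - b) / (a * t - b * t').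
pose q := t * (a - b) / (a * t - b * t').
have p01 : 0 <= p <= 1.
  by rewrite /p divr_ge0 ?ler_pdivrMr//=; nra.
have q01 : 0 <= q <= 1.
  by rewrite /q divr_ge0 ?ler_pdivrMr//=; nra.
have nz : [/\ t != 0, t' != 0 & a * t - b * t' != 0] by rewrite !gt_eqF.
case: nz => tn t'n Dn.
have ea : a / t = p * (a / t') + (1 - p) * (b / t) by rewrite /p; field; apply/and3P.
have eb : b / t' = q * (b / t) + (1 - q) * (a / t') by rewrite /q; field; apply/and3P.
have fa := cf p (a / t') (b / t) p01 I I.
have fb := cf q (b / t) (a / t') q01 I I.
rewrite -ea in fa; rewrite -eb in fb.
have pq : t * p = t' * q by rewrite /p /q; field.
rewrite -(ler_pM2l t0) in fa; rewrite -(ler_pM2l t'0) in fb.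
apply: le_trans (lerD fa fb) _; set A := f (a / t'); set B := f (b / t).
have -> : t * (p * A + (1 - p) * B) + t' * (q * B + (1 - q) * A)
  = t' * A + t * B + (t * p - t' * q) * (A - B) by ring.
by rewrite pq subrr mul0r addr0.
Qed.

(** * Finiteness and convexity of the convex transform *)

Section ConvexTransform.
Context {R : realType} {Q : R -> R} {kjam : R}.

(** A concave function that vanishes at both ends is at the midpoint at least half
    of [Q k], because the midpoint is a barycentre of [k] and the end
    farther from [k], with weight at least one half on [k]. *)
Lemma diagram_le {vf w k : R} : fundamental_diagram Q kjam vf w ->
  0 <= k <= kjam -> Q k <= 2 * Q (kjam / 2).
Proof.
move=> hQ k01; have /convex_functionP cQ := fd_concave hQ.
have kj0 := fd_kjam_gt0 hQ; have Qk0 := fd_ge0 hQ k01.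
have [k0 kj] := andP k01.
have I_ y : 0 <= y <= kjam -> `[0, kjam]%classic y by rewrite /= in_itv.
have [km|km] := leP (kjam / 2) k.
- have k_gt0 : 0 < k by nra.
  have p01 : 0 <= kjam / 2 / k <= 1.
    by rewrite divr_ge0 ?ler_pdivrMr//=; lra.
  have hp : 1 / 2 <= kjam / 2 / k by rewrite ler_pdivlMr//; lra.
  have := cQ _ k 0 p01 (I_ _ k01) (I_ _ _).
  rewrite (fd_Q0 hQ) mulr0 addr0 divfK ?gt_eqF// lexx ltW// => /(_ isT).
  by nra.
- have d_gt0 : 0 < kjam - k by nra.
  have p01 : 0 <= kjam / 2 / (kjam - k) <= 1.
    by rewrite divr_ge0 ?ler_pdivrMr//=; lra.
  have hp : 1 / 2 <= kjam / 2 / (kjam - k) by rewrite ler_pdivlMr//; lra.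
  have := cQ _ k kjam p01 (I_ _ k01) (I_ _ _).
  rewrite (fd_Qkjam hQ) lexx ltW// => /(_ isT).
  set p := kjam / 2 / _ in p01 hp *.
  have -> : p * k + (1 - p) * kjam = kjam / 2.
    by rewrite /p; field; rewrite gt_eqF.
  by nra.
Qed.

Lemma convex_transform_fin_num {vf w : R} (u : R) : fundamental_diagram Q kjam vf w ->
  convex_transform Q kjam u \is a fin_num.
Proof.
move=> hQ; have kj0 := fd_kjam_gt0 hQ.
rewrite fin_numElt; apply/andP; split.
  apply: (@lt_le_trans _ _ (Q 0 - u * 0)%:E); first exact: ltNyr.
  by apply: ereal_sup_ubound; exists 0 => //=; rewrite in_itv/= lexx ltW.
apply: (@le_lt_trans _ _ (2 * Q (kjam / 2) + `|u| * kjam)%:E); last exact: ltry.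
apply: ge_ereal_sup => _ [k + <-]; rewrite /= in_itv/= => k01.
rewrite lee_fin -mulNr lerD ?(diagram_le hQ k01)//.
have [k0 kj] := andP k01; apply: le_trans (ler_norm _) _.
by rewrite normrM normrN ler_wpM2l// ger0_norm.
Qed.

(** A supremum of affine functions is convex. *)
Lemma convex_transform_convex {vf w : R} : fundamental_diagram Q kjam vf w ->
  convex_function (setT : set (convex_lmodType R^o))
    (fun u : R => fine (convex_transform Q kjam u)).
Proof.
move=> hQ; apply/convex_functionP => p u v /andP[p0 p1] _ _.
have fin x := convex_transform_fin_num x hQ.
have ub k x : k \in `[0, kjam] -> Q k - x * k <= fine (convex_transform Q kjam x).
  by move=> kI; rewrite -lee_fin fineK//; apply: ereal_sup_ubound; exists k.
rewrite -lee_fin fineK//; apply: ge_ereal_sup => _ [k kI <-]; rewrite lee_fin.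
have := ub k u kI; have := ub k v kI; nra.
Qed.

End ConvexTransform.

(** * Solution components *)

Definition straight_cost {R : realType} (Q : R -> R) (kjam : R)
    (k b : nat -> R) (i : nat) (x y t : R) : R :=
  - k i * y + b i + t * fine (convex_transform Q kjam ((x - y) / t)).

Section Component.
Context {R : realType} {Q : R -> R} {kjam vf w : R}.
Hypothesis hQ : fundamental_diagram Q kjam vf w.
Context {xs k b : nat -> R}.

Lemma straight_costE {i x y t} : xs i <= y <= xs i.+1 ->
  (c_ini xs k b i y + t%:E * convex_transform Q kjam ((x - y) / t))%E =
  (straight_cost Q kjam k b i x y t)%:E.
Proof.
move=> yi; rewrite /c_ini yi -[convex_transform _ _ _]fineK//.
exact: convex_transform_fin_num hQ.
Qed.

(** Downstream of the block the velocity [(x - y) / t] is nonnegative, hence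
    above [- w]. *)
Lemma N_ini_le_cost {i x y t} : 0 < t -> xs i <= y <= xs i.+1 -> y <= x ->
  (x - y) / t <= vf ->
  (N_ini Q kjam vf w xs k b i x t <= (straight_cost Q kjam k b i x y t)%:E)%E.
Proof.
move=> t0 yi yx yv; rewrite /N_ini gt_eqF//.
apply: ereal_inf_lbound; exists y; last exact: straight_costE.
split=> //; apply/andP; split=> //.
apply: (@le_trans _ _ 0); first by rewrite oppr_le0 ltW ?(fd_w_gt0 hQ).
by rewrite divr_ge0 ?subr_ge0// ltW.
Qed.

Lemma N_ini_lt_cost {i x t} {z : \bar R} : 0 < t ->
  (N_ini Q kjam vf w xs k b i x t < z)%E ->
  exists y, [/\ xs i <= y <= xs i.+1, (x - y) / t <= vf
              & ((straight_cost Q kjam k b i x y t)%:E < z)%E].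
Proof.
move=> t0; rewrite /N_ini gt_eqF// => /ereal_inf_lt[_ [y [yi /andP[_ yv]] <-]].
by rewrite straight_costE// => lt_z; exists y.
Qed.

End Component.

Lemma block_points_le {R : realType} {kjam : R} {n : nat} {xs k b : nat -> R}
    {i j : nat} :
  initial_blocks kjam n xs k b -> (i <= j)%N -> (j <= n)%N -> xs i <= xs j.
Proof.
move=> hini; elim: j => [|j IH]; first by rewrite leqn0 => /eqP->.
rewrite leq_eqVlt => /predU1P[->//|ij] jn.
exact: le_trans (IH ij (ltnW jn)) (ltW (ib_increasing hini jn)).
Qed.

Theorem theorem1 (R : realType) (Q : R -> R) (kjam vf w : R)
    (hQ : fundamental_diagram Q kjam vf w)
    (n_ini : nat) (xs k b : nat -> R)
    (hini : initial_blocks kjam n_ini xs k b)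
    (i j : nat) (hij : (i < j)%N) (hj : (j < n_ini)%N)
    (t' : R) (ht' : (xs n_ini - xs i.+1) / vf <= t')
    (hle : (N_ini Q kjam vf w xs k b i (xs n_ini) t'
            <= N_ini Q kjam vf w xs k b j (xs n_ini) t')%E) :
  forall t : R, t' <= t ->
    (N_ini Q kjam vf w xs k b i (xs n_ini) t
     <= N_ini Q kjam vf w xs k b j (xs n_ini) t)%E.
Proof.
move=> t t't.
set X := xs n_ini in ht' hle *.
have vf0 := fd_vf_gt0 hQ.
have xij : xs i.+1 <= xs j by apply: block_points_le hini hij (ltnW hj).
have xjX : xs j.+1 <= X by exact: block_points_le hini hj (leqnn _).
have xjj : xs j < xs j.+1 := ib_increasing hini hj.
have t'0 : 0 < t'.
  by apply: lt_le_trans ht'; rewrite divr_gt0// subr_gt0; lra.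
have t0 : 0 < t by exact: lt_le_trans t't.
rewrite leNgt; apply/negP => /(N_ini_lt_cost hQ t0) [z [zj zv]].
have [jz zj'] := andP zj.
(* The slack [e] stands in for an exact minimizer of [N_i] at time [t']. *)
apply/negP; rewrite -leNgt; apply/lee_addgt0Pr => e e0.
have zX := le_trans zj' xjX.
have zv' : (X - z) / t' <= vf.
  by move: ht'; rewrite !ler_pdivrMr// mulrC; lra.
have : (N_ini Q kjam vf w xs k b i X t'
        < (straight_cost Q kjam k b j X z t' + e)%:E)%E.
  apply: le_lt_trans (le_trans hle (N_ini_le_cost hQ t'0 zj zX zv')) _.
  by rewrite lte_fin ltrDl.
move=> /(N_ini_lt_cost hQ t'0) [y [yi yv lt_y]].
have [iy yi'] := andP yi.
have yz : y <= z by exact: le_trans yi' (le_trans xij jz).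
have yv' : (X - y) / t <= vf.
  apply: le_trans yv; rewrite ler_wpM2l ?subr_ge0 ?(le_trans yz)//.
  by rewrite lef_pV2 ?posrE.
have yX := le_trans yz zX.
apply: le_trans (N_ini_le_cost hQ t0 yi yX yv') _.
have := @convex_perspective_exchange _ _ (X - y) (X - z) t t'
  (convex_transform_convex hQ).
rewrite subr_ge0 lerD2l lerN2 => /(_ zX yz t'0 t't).
by rewrite -EFinD lee_fin; move: lt_y; rewrite lte_fin /straight_cost; lra.
Qed.
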